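(* Let $\tilde J$ be a self-adjoint extension on $\ell^2(\mathbb{N}_0)$ of the Jacobi operator $J$. If the essential spectrum of $\tilde J$ is empty, then $$\lim_{n\to\infty}\int_{\mathbb{R}}f\,\mathrm{d}\eta_n=\int_{\mathbb{R}}f\,\mathrm{d}\eta_\infty$$ for any function $f\in L^1(\eta_\infty)$, where $$\eta_\infty=\sum_{\zeta\in\sigma(\tilde J)}\delta_\zeta .$$
   Context: Let $(a_n)_{n\ge0}$ be positive numbers, $(b_n)_{n\ge0}$ real numbers. The Jacobi operator $J$ is the closure in $\ell^2(\mathbb{N}_0)$, $\mathbb{N}_0=\{0,1,2,\dots\}$, of the action on finitely supported sequences of the infinite symmetric tridiagonal matrix with diagonal entries $b_0,b_1,\dots$ and off-diagonal entries $a_0,a_1,\dots$ (no positivity is assumed). The orthonormal polynomials are $P_0\equiv1$, $P_1(z)=(z-b_0)/a_0$, $zP_n(z)=a_{n-1}P_{n-1}(z)+b_nP_n(z)+a_nP_{n+1}(z)$, $n\ge1$. Let $\tilde\mu(\cdot)=\langle\boldsymbol e_0,E_{\tilde J}(\cdot)\boldsymbol e_0\rangle$, where $E_{\tilde J}$ is the projection-valued spectral measure of $\tilde J$ and $\boldsymbol e_0=(1,0,0,\dots)$. For $n\ge1$ the Christoffel--Darboux kernel is $K_n(x,y)=\sum_{j=0}^{n-1}P_j(x)P_j(y)$, and $\eta_n$ is the measure on $\mathbb{R}$ with $\mathrm{d}\eta_n=K_n(x,x)\,\mathrm{d}\tilde\mu(x)$. $\delta_\zeta$ denotes the Dirac measure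 at $\zeta$. *)

(* Defs.v *)
From HB Require Import structures.
From mathcomp Require Import all_boot all_order all_algebra.
From mathcomp Require Import complex.
From mathcomp Require Import all_classical all_reals all_analysis.

Set Implicit Arguments.
Unset Strict Implicit.
Unset Printing Implicit Defensive.

Import Order.TTheory GRing.Theory Num.Theory.
Import numFieldNormedType.Exports.

Local Open Scope complex_scope.
Local Open Scope classical_set_scope.
Local Open Scope ring_scope.

(* [R[i]^o] is the field of complex numbers with its usual topology; complex
   sequences [nat -> R[i]^o] form a complex vector space pointwise. *)
Notation cseq R := (nat -> R[i]^o).

Section SquareSummable.
Context {R : realType}.
Implicit Types u v : cseq R.

Definition sqnorm u : \bar R :=
  (\sum_(0 <= k <oo) ((ComplexField.Normc.normc (u k)) ^+ 2)%:E)%E.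

Definition l2 : set (cseq R) := [set u | (sqnorm u < +oo)%E].

(* Conjugate-linear in the first argument; only meaningful on [l2]. *)
Definition inner u v : R[i]^o :=
  limn (series (fun k => ((u k)^* * v k : R[i]^o))).

Definition l2_cvg (s : nat -> cseq R) u : Prop :=
  sqnorm (s n - u) @[n --> \oo] --> (0 : \bar R)%E.

Definition e0 : cseq R := fun n => (n == 0)%:R.

End SquareSummable.

(* A (possibly unbounded) operator in l2 is identified with its graph, so that
   "S extends T" is the inclusion [T `<=` S]. *)
Section Operators.
Context {R : realType}.
Implicit Types (T : set (cseq R * cseq R)) (u v : cseq R) (z : R[i]^o).

Definition is_operator T : Prop :=
  [/\ T `<=` l2 `*` l2,
      T (0, 0),
      forall z u u' v v', T (u, v) -> T (u', v') ->
        T (z *: u + u', z *: v + v')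
    & forall u v w, T (u, v) -> T (u, w) -> v = w].

Definition dom T : set (cseq R) := [set u | exists v, T (u, v)].

Definition densely_defined T : Prop :=
  forall u, l2 u -> exists s, (forall n, dom T (s n)) /\ l2_cvg s u.

Definition graph_closure T : set (cseq R * cseq R) :=
  [set p | [/\ l2 p.1, l2 p.2 &
    exists s t : nat -> cseq R,
      [/\ forall n, T (s n, t n), l2_cvg s p.1 & l2_cvg t p.2]]].

Definition adjoint T : set (cseq R * cseq R) :=
  [set p | [/\ l2 p.1, l2 p.2 &
    forall u v, T (u, v) -> inner p.1 v = inner p.2 u]].

Definition self_adjoint T : Prop :=
  [/\ is_operator T, densely_defined T & adjoint T = T].

(* [T - z] is a bijection from [dom T] onto l2 with bounded inverse. *)
Definition resolvent_set T : set R[i]^o :=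
  [set z | (forall u, T (u, z *: u) -> u = 0) /\
    exists M : R, forall v, l2 v ->
      exists u, T (u, v + z *: u) /\ (sqnorm u <= M%:E * sqnorm v)%E].

Definition spectrum T : set R[i]^o := ~` resolvent_set T.

Definition eigenspace T z : set (cseq R) := [set u | T (u, z *: u)].

Definition finite_dimensional (V : set (cseq R)) : Prop :=
  exists (n : nat) (w : 'I_n -> cseq R), forall u, V u ->
    exists c : 'I_n -> R[i]^o, u = \sum_(i < n) c i *: w i.

(* Isolated points of the spectrum that are eigenvalues of finite
   multiplicity. *)
Definition discrete_spectrum T : set R[i]^o :=
  [set z | [/\ spectrum T z,
      \forall w \near z, spectrum T w -> w = z,
      exists u, u != 0 /\ eigenspace T z u
    & finite_dimensional (eigenspace T z)]].

Definition essential_spectrum T : set R[i]^o :=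
  spectrum T `\` discrete_spectrum T.

End Operators.

Section SpectralMeasure.
Context {R : realType}.
Implicit Types (T : set (cseq R * cseq R)) (u v : cseq R).
Implicit Type E : set (measurableTypeR R) -> cseq R -> cseq R.

Definition orthogonal_projection (P : cseq R -> cseq R) : Prop :=
  [/\ forall u, l2 u -> l2 (P u),
      forall (z : R[i]^o) u v, l2 u -> l2 v -> P (z *: u + v) = z *: P u + P v,
      forall u, l2 u -> P (P u) = P u
    & forall u v, l2 u -> l2 v -> inner (P u) v = inner u (P v)].

Definition projection_valued_measure E : Prop :=
  [/\ forall A, measurable A -> orthogonal_projection (E A),
      forall u, l2 u -> E setT u = u
    & forall F : nat -> set (measurableTypeR R),
        (forall i, measurable (F i)) -> trivIset setT F ->
        forall u, l2 u ->
          l2_cvg (fun n => \sum_(0 <= i < n) E (F i) u) (E (\bigcup_i F i) u)].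

(* [<u, E(.) u>], whose values are nonnegative reals on measurable sets. *)
Definition scalar_measure E u (A : set (measurableTypeR R)) : \bar R :=
  (complex.Re (inner u (E A u)))%:E.

(* [T = \int x dE(x)]: the domain of [T] consists of the [u] in l2 such that
   [\int x^2 d<u, E u>] is finite, and [<u, T u> = \int x d<u, E u>] on it. *)
Definition spectral_measure_of T E : Prop :=
  [/\ projection_valued_measure E,
      forall u, l2 u ->
        (dom T u <-> (\int[scalar_measure E u]_x (x ^+ 2)%:E < +oo)%E)
    & forall u v, T (u, v) ->
        inner u v = (fine (\int[scalar_measure E u]_x x%:E)%E)%:C].

End SpectralMeasure.

Section Jacobi.
Context {R : realType}.
Variables a b : nat -> R.

Definition jacobi_action (u : cseq R) : cseq R := fun n =>
  (if n is m.+1 then (a m)%:C * u m else 0)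
    + (b n)%:C * u n + (a n)%:C * u n.+1.

Definition finitely_supported (u : cseq R) : Prop :=
  exists N : nat, forall n, (N <= n)%N -> u n = 0.

Definition jacobi_operator : set (cseq R * cseq R) :=
  graph_closure [set (u, jacobi_action u) | u in finitely_supported].

Fixpoint orthopoly (n : nat) : {poly R} :=
  match n with
  | 0 => 1
  | (k.+1 as m).+1 =>
      (a m)^-1 *: (('X - (b m)%:P) * orthopoly m - a k *: orthopoly k)
  | 1 => (a 0)^-1 *: ('X - (b 0)%:P)
  end.

Definition cd_kernel (n : nat) (x y : R) : R :=
  \sum_(0 <= j < n) (orthopoly j).[x] * (orthopoly j).[y].

End Jacobi.

Section Integrals.
Context {R : realType}.
Implicit Type mu : set (measurableTypeR R) -> \bar R.

Definition density_measure mu (k : R -> R) (A : set (measurableTypeR R)) :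
    \bar R := (\int[mu]_(x in A) (k x)%:E)%E.

(* The sum of the Dirac measures at the points of [S]. *)
Definition point_masses (S : set R) (A : set (measurableTypeR R)) : \bar R :=
  (\esum_(x in S) (\d_(x : measurableTypeR R) A : \bar R))%E.

(* The spectrum of a self-adjoint operator is contained in the real line. *)
Definition real_spectrum (T : set (cseq R * cseq R)) : set R :=
  [set x | spectrum T x%:C].

Definition cintegrable mu (f : R -> R[i]) : Prop :=
  integrable mu setT (fun x => (complex.Re (f x))%:E) /\
  integrable mu setT (fun x => (complex.Im (f x))%:E).

Definition cintegral mu (f : R -> R[i]) : R[i]^o :=
  (fine (\int[mu]_x (complex.Re (f x))%:E)%E)
    +i* (fine (\int[mu]_x (complex.Im (f x))%:E)%E).

End Integrals.

(* Main.v *)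
Require Import Defs.
From HB Require Import structures.
From mathcomp Require Import all_boot all_order all_algebra.
From mathcomp Require Import complex ring lra.
From mathcomp Require Import all_classical all_reals all_analysis.
From mathcomp Require Import measurable_realfun.

Import Order.TTheory GRing.Theory Num.Theory.
Import numFieldNormedType.Exports.

Set Implicit Arguments.
Unset Strict Implicit.
Unset Printing Implicit Defensive.

Local Open Scope classical_set_scope.
Local Open Scope ring_scope.

(* Every real point zeta of the spectrum is an isolated eigenvalue. As T extends
   the Jacobi operator, an eigenvector solves the three-term recurrence, so it
   is a multiple of p = (P_n(zeta))_n; hence E({zeta}) e_0 = p / |p|^2 and
   mu({zeta}) = 1 / sum_j P_j(zeta)^2. Near a real point x of the resolvent set
   E vanishes, because T - x is small on the range of E([x - e, x + e]) although
   its inverse is bounded; by a Lindeloef argument mu is carried by the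
   spectrum. Therefore eta_n({zeta}) = K_n(zeta, zeta) mu({zeta}) increases to
   1, and dominated convergence with respect to eta_oo concludes.

   The operator is unbounded and only the quadratic form <u, T u> is given as
   an integral against E, so everything is done on the ranges of E(A) for
   bounded A. Only the real inner product Re <u, v> is needed. *)

(** * The real inner product on l2 *)

Section RealInner.
Context {R : realType}.
Implicit Types (u v : cseq R) (z w : R[i]).

(** This is the real part of [z^* * w], that is, the Euclidean inner product of the plane. *)
Definition dot (z w : R[i]) : R :=
  complex.Re z * complex.Re w + complex.Im z * complex.Im w.

Lemma dotC z w : dot z w = dot w z.
Proof. by rewrite /dot mulrC [X in _ + X]mulrC. Qed.

Lemma dotDl z1 z2 w : dot (z1 + z2) w = dot z1 w + dot z2 w.
Proof. by case: z1 z2 w => [? ?] [? ?] [? ?]; rewrite /dot/=; ring. Qed.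

Lemma dotZl (r : R) z w : dot (r%:C%C * z) w = r * dot z w.
Proof. by case: z w => [? ?] [? ?]; rewrite /dot/=; ring. Qed.

Lemma dotMM z w : dot (z * w) (z * w) = dot z z * dot w w.
Proof. by case: z w => [? ?] [? ?]; rewrite /dot/=; ring. Qed.

Lemma dot_ge0 z : 0 <= dot z z.
Proof. by rewrite /dot -!expr2 addr_ge0 ?sqr_ge0. Qed.

Lemma dot_eq0 z : dot z z = 0 -> z = 0.
Proof.
case: z => x y; rewrite /dot/= => /eqP.
by rewrite -!expr2 paddr_eq0 ?sqr_ge0// !sqrf_eq0 => /andP[/eqP-> /eqP->].
Qed.

Lemma sqr_normc_dot z : ComplexField.Normc.normc z ^+ 2 = dot z z.
Proof.
by case: z => x y /=; rewrite sqr_sqrtr ?addr_ge0 ?sqr_ge0// /dot !expr2.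
Qed.

Lemma ler_norm_dot z w : `|dot z w| <= dot z z + dot w w.
Proof.
case: z w => [a b] [c d]; rewrite /dot/= ler_norml.
have := (sqr_ge0 (a - c), sqr_ge0 (a + c), sqr_ge0 (b - d), sqr_ge0 (b + d)).
move=> [[[? ?] ?] ?].
have := (sqr_ge0 a, sqr_ge0 b, sqr_ge0 c, sqr_ge0 d) => -[[[? ?] ?] ?].
by apply/andP; split; nra.
Qed.

Lemma nneseries_EFin (f : nat -> R) : cvgn (series f) ->
  (\sum_(0 <= k <oo) (f k)%:E)%E = (limn (series f))%:E.
Proof.
move=> cf; rewrite -EFin_lim//; congr (limn _).
by apply/funext => n /=; rewrite sumEFin.
Qed.

Lemma cvg_nneseries_EFin (f : nat -> R) : (forall k, 0 <= f k) ->
  (\sum_(0 <= k <oo) (f k)%:E < +oo)%E -> cvgn (series f).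
Proof.
move=> f0 foo; apply: nondecreasing_is_cvgn.
  by apply/nondecreasing_seqP => n; rewrite -subr_ge0 seriesSB.
exists (fine (\sum_(0 <= k <oo) (f k)%:E)%E) => _ [n _ <-].
rewrite -lee_fin fineK; last first.
  rewrite ge0_fin_numE//; apply: nneseries_ge0 => *; by rewrite lee_fin.
rewrite -sumEFin; apply: nneseries_lim_ge => *; by rewrite lee_fin.
Qed.

(** On [l2] this is the real part of [inner u v]. It makes [l2] a real inner product space, so that
    limits and inequalities stay in [R]. *)
Definition rinner u v : R := limn (series (fun k => dot (u k) (v k))).

Lemma sqnormEdot u : sqnorm u = (\sum_(0 <= k <oo) (dot (u k) (u k))%:E)%E.
Proof. by apply: eq_eseriesr => k _; rewrite sqr_normc_dot. Qed.

Lemma l2P u : l2 u <-> cvgn (series (fun k => dot (u k) (u k))).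
Proof.
rewrite /l2/= sqnormEdot; split => [|/nneseries_EFin ->]; last by rewrite ltry.
by apply: cvg_nneseries_EFin => k; exact: dot_ge0.
Qed.

Lemma sqnormE u : l2 u -> sqnorm u = (rinner u u)%:E.
Proof. by move=> /l2P lu; rewrite sqnormEdot nneseries_EFin. Qed.

Lemma is_cvg_rinner u v : l2 u -> l2 v ->
  cvgn (series (fun k => dot (u k) (v k))).
Proof.
move=> /l2P lu /l2P lv; apply: normed_cvg.
have := is_cvg_seriesD lu lv; apply: series_le_cvg => k //=.
- by rewrite !fctE addr_ge0// dot_ge0.
- exact: ler_norm_dot.
Qed.

Lemma cvg_rinner u v : l2 u -> l2 v ->
  series (fun k => dot (u k) (v k)) @ \oo --> rinner u v.
Proof. exact: is_cvg_rinner. Qed.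

Lemma l2Z z u : l2 u -> l2 ((z : R[i]^o) *: u).
Proof.
move=> /l2P lu; apply/l2P.
rewrite (_ : (fun _ => _) = dot z z *: (fun k => dot (u k) (u k))).
  exact: is_cvg_seriesZ.
by apply/funext => k; exact: dotMM.
Qed.

Lemma l2D u v : l2 u -> l2 v -> l2 (u + v).
Proof.
move=> /l2P lu /l2P lv; apply/l2P.
have := is_cvg_seriesZ (k := 2) (is_cvg_seriesD lu lv).
apply: series_le_cvg => k /=.
- exact: dot_ge0.
- by rewrite mulr_ge0// addr_ge0// dot_ge0.
rewrite !fctE; case: (u k) (v k) => [a b] [c d]; rewrite /dot/=.
have := (sqr_ge0 (a - c), sqr_ge0 (b - d)) => -[].
by rewrite /GRing.scale/=; nra.
Qed.

Lemma l2_0 : l2 (0 : cseq R).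
Proof.
apply/l2P; rewrite (_ : (fun _ => _) = cst 0); last first.
  by apply/funext => k; rewrite /dot/= !mul0r addr0.
rewrite (_ : series _ = cst 0); first exact: is_cvg_cst.
by apply/funext => n; rewrite /series/= big1.
Qed.

Lemma l2N u : l2 u -> l2 (- u).
Proof. by rewrite -scaleN1r; exact: l2Z. Qed.

Lemma l2B u v : l2 u -> l2 v -> l2 (u - v).
Proof. by move=> lu lv; apply: l2D => //; exact: l2N. Qed.

Lemma rinnerC u v : rinner u v = rinner v u.
Proof. by rewrite /rinner; under eq_fun do rewrite dotC. Qed.

Lemma rinnerDl u1 u2 v : l2 u1 -> l2 u2 -> l2 v ->
  rinner (u1 + u2) v = rinner u1 v + rinner u2 v.
Proof.
move=> l1 l2 lv; rewrite /rinner -lim_seriesD; [|exact: is_cvg_rinner..].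
congr (limn (series _)); apply/funext => k.
by rewrite !fctE dotDl.
Qed.

Lemma rinnerZl (r : R) u v : l2 u -> l2 v ->
  rinner ((r%:C%C : R[i]^o) *: u) v = r * rinner u v.
Proof.
move=> lu lv; rewrite -[RHS]lim_seriesZ; last exact: is_cvg_rinner.
congr (limn (series _)); apply/funext => k.
exact: dotZl.
Qed.

Lemma rinnerNl u v : l2 u -> l2 v -> rinner (- u) v = - rinner u v.
Proof.
move=> lu lv; rewrite -[LHS]opprK; congr (- _).
by rewrite -[LHS]mulN1r -rinnerZl ?rmorphN1 ?scaleN1r ?opprK//; exact: l2N.
Qed.

Lemma rinnerBl u1 u2 v : l2 u1 -> l2 u2 -> l2 v ->
  rinner (u1 - u2) v = rinner u1 v - rinner u2 v.
Proof. by move=> l1 l2 lv; rewrite rinnerDl ?rinnerNl//; exact: l2N. Qed.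

Lemma rinnerDr u v1 v2 : l2 v1 -> l2 v2 -> l2 u ->
  rinner u (v1 + v2) = rinner u v1 + rinner u v2.
Proof. by move=> *; rewrite rinnerC rinnerDl// rinnerC [X in _ + X]rinnerC. Qed.

Lemma rinnerBr u v1 v2 : l2 v1 -> l2 v2 -> l2 u ->
  rinner u (v1 - v2) = rinner u v1 - rinner u v2.
Proof. by move=> *; rewrite rinnerC rinnerBl// rinnerC [X in _ - X]rinnerC. Qed.

Lemma rinnerZr (r : R) u v : l2 u -> l2 v ->
  rinner u ((r%:C%C : R[i]^o) *: v) = r * rinner u v.
Proof. by move=> *; rewrite rinnerC rinnerZl// rinnerC. Qed.

Lemma rinner0l v : rinner 0 v = 0.
Proof.
rewrite /rinner (_ : series _ = cst 0) ?lim_cst//.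
by apply/funext => n; rewrite /series/= big1// => i _; rewrite /dot !mul0r addr0.
Qed.

Lemma rinner0r u : rinner u 0 = 0.
Proof. by rewrite rinnerC rinner0l. Qed.

Lemma rinner_ge0 u : l2 u -> 0 <= rinner u u.
Proof.
move=> /l2P lu; apply: limr_ge => //.
by apply: nearW => n; rewrite sumr_ge0// => *; exact: dot_ge0.
Qed.

Lemma rinner_eq0 u : l2 u -> rinner u u = 0 -> u = 0.
Proof.
move=> lu u0; have := sqnormE lu; rewrite u0 sqnormEdot => s0.
apply/funext => k; apply: dot_eq0; apply/eqP.
rewrite eq_le dot_ge0 andbT -lee_fin -s0.
rewrite (@nneseriesD1 _ _ k xpredT)//; last first.
  by move=> *; rewrite lee_fin dot_ge0.
rewrite leeDl//; apply: nneseries_ge0 => *; by rewrite lee_fin dot_ge0.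
Qed.

Lemma rinnerDD u v : l2 u -> l2 v ->
  rinner (u + v) (u + v) = rinner u u + rinner v v + 2 * rinner u v.
Proof.
move=> lu lv; rewrite rinnerDl// ?rinnerDr//; try exact: l2D.
by rewrite [rinner v u]rinnerC; ring.
Qed.

(** A weighted form of Cauchy-Schwarz without square roots: expand the squared norm of [- t u + s v]
    for [s = 1] and [s = -1], then divide by [t]. *)
Lemma normr_rinner (t : R) u v : 0 < t -> l2 u -> l2 v ->
  2 * `|rinner u v| <= t * rinner u u + t^-1 * rinner v v.
Proof.
move=> t0 lu lv.
have H (s : R) : s ^+ 2 = 1 ->
    2 * (s * rinner u v) <= t * rinner u u + t^-1 * rinner v v.
  move=> s1; have lw := l2Z (- t)%:C%C lu; have lsv := l2Z s%:C%C lv.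
  have := rinner_ge0 (l2D lw lsv).
  rewrite rinnerDD// !rinnerZl// !rinnerZr// => H.
  rewrite -(ler_pM2l t0) mulrDr mulVKf ?gt_eqF// -subr_ge0.
  apply: le_trans H _; rewrite le_eqVlt; apply/orP; left; apply/eqP.
  by rewrite -[rinner v v in RHS]mul1r -s1; ring.
case: (ger0P (rinner u v)) => uv.
  by have := H 1 (expr1n _ _); rewrite mul1r.
by have := H (-1) ltac:(by rewrite sqrrN expr1n); rewrite mulN1r.
Qed.

Lemma l2_cvg_rinner (w : cseq R) (s : nat -> cseq R) u :
  l2 w -> (forall n, l2 (s n)) -> l2 u -> l2_cvg s u ->
  rinner w (s n) @[n --> \oo] --> rinner w u.
Proof.
move=> lw ls lu su; apply/cvgrPdist_le => e e0.
(* This weight gives [t |w|^2 <= e], and [t^-1 |s n - u|^2 <= e] as soon as [|s n - u|^2 <= t e].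
   The [+ 1] keeps the denominator positive when [w = 0]. *)
pose t := e / (rinner w w + 1).
have w1 : 0 < rinner w w + 1 by rewrite ltr_wpDl// rinner_ge0.
have t0 : 0 < t by rewrite divr_gt0.
have te0 : 0 < t * e by rewrite mulr_gt0.
have := su; rewrite /l2_cvg; under eq_fun do rewrite (sqnormE (l2B _ _))//.
move=> /fine_cvgP[_ /cvgrPdist_le/(_ _ te0)]; apply: filterS => n /=.
rewrite sub0r normrN ger0_norm ?rinner_ge0//; last exact: l2B.
move=> H; rewrite -rinnerBr// -opprB rinnerC rinnerNl ?normrN//; last exact: l2B.
rewrite rinnerC.
have := normr_rinner t0 lw (l2B (ls n) lu).
have : t * rinner w w <= e.
  by rewrite /t mulrAC ler_pdivrMr// ler_pM2l// lerDl.
have : t^-1 * rinner (s n - u) (s n - u) <= e by rewrite ler_pdivrMl.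
by move=> *; lra.
Qed.

(** Pairing the sequence with [u - v] has a single limit, so [u] and [v] have the same inner product
    with [u - v], whose norm is then zero. *)
Lemma l2_cvg_unique (s : nat -> cseq R) u v :
  (forall n, l2 (s n)) -> l2 u -> l2 v -> l2_cvg s u -> l2_cvg s v -> u = v.
Proof.
move=> ls lu lv su sv; apply/eqP; rewrite -subr_eq0; apply/eqP.
have luv := l2B lu lv; apply: rinner_eq0 => //.
rewrite rinnerBr//; apply/eqP; rewrite subr_eq0; apply/eqP.
exact: (cvg_unique _ (l2_cvg_rinner luv ls lu su) (l2_cvg_rinner luv ls lv sv)).
Qed.

Lemma cvg_complex (x y : nat -> R) (a b : R) :
  x @ \oo --> a -> y @ \oo --> b ->
  (fun n => (x n +i* y n)%C : R[i]^o) @ \oo --> ((a +i* b)%C : R[i]^o).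
Proof.
move=> xa yb; apply/cvgrPdist_lt => e e0.
(* In the partial order of [R[i]] a positive element has zero imaginary part, so the tolerance is a
   real number. *)
have {e0} [d d0 ->] : exists2 d : R, 0 < d & e = d%:C%C.
  by case: e e0 => d c; rewrite ltcE/= => /andP[/eqP-> ?]; exists d.
have d2 : 0 < d / 2 by rewrite divr_gt0.
move/cvgrPdist_lt : xa => /(_ _ d2) xa; move/cvgrPdist_lt : yb => /(_ _ d2) yb.
near=> n.
have -> : ((a +i* b)%C : R[i]^o) - (x n +i* y n)%C =
    ((a - x n)%:C + ((b - y n)%:C * 'i))%C.
  by apply/eqP; rewrite eq_complex/=; simpc.
rewrite (le_lt_trans (ler_normD _ _))// normrM.
rewrite !normc_def /= !expr0n/= !addr0 add0r expr1n sqrtr1 mulr1 !sqrtr_sqr.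
rewrite -rmorphD ltcR [ltRHS]splitr ltrD//; near: n; assumption.
Unshelve. all: end_near. Qed.

(** Conjugate-linearity gives [<iu, v> = - i <u, v>], whose real part is the imaginary part of
    [<u, v>]. *)
Lemma innerE u v : l2 u -> l2 v ->
  inner u v = (rinner u v +i* rinner (('i%C : R[i]^o) *: u) v)%C.
Proof.
move=> lu lv; have liu := l2Z 'i%C lu; apply/cvg_lim => //.
have := cvg_complex (cvg_rinner lu lv) (cvg_rinner liu lv).
rewrite [X in X @ \oo --> _ -> _](_ : _ =
  series (fun k => ((u k)^*%C * v k : R[i]^o)))//.
apply/funext => n; elim: n => [|n IH].
  by rewrite /series/= !big_geq.
have E (V : zmodType) (f : nat -> V) : series f n.+1 = f n + series f n.
  by rewrite -[RHS]addrC seriesSr.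
rewrite !E -IH (_ : (_ *: u) n = 'i%C * u n)//.
case: (u n) (v n) => [x y] [z w]; rewrite /dot/=.
by apply/eqP; rewrite eq_complex/=; apply/andP; split; apply/eqP; ring.
Qed.

Lemma Re_inner u v : l2 u -> l2 v -> complex.Re (inner u v) = rinner u v.
Proof. by move=> lu lv; rewrite innerE. Qed.

End RealInner.

(** * Measures carried by a countable set *)

Section MeasureGenerics.
Context d (T : measurableType d) (R : realType).
Local Open Scope ereal_scope.
Import HBNNSimple.
Implicit Types (m : set T -> \bar R) (nu : {measure set T -> \bar R}).

(** Replaces raw set functions such as [scalar_measure] by bundled measures, to which integration
    theory applies. *)
Lemma measure_agreeing m : m set0 = 0 ->
  (forall A, measurable A -> 0 <= m A) ->
  (forall F : nat -> set T, (forall i, measurable (F i)) -> trivIset setT F ->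
    (fun n => \sum_(0 <= i < n) m (F i)) @ \oo --> m (\bigcup_i F i)) ->
  exists nu, forall A, measurable A -> nu A = m A.
Proof.
move=> m0 mge0 madd.
(* Nothing is known about [m] on nonmeasurable sets, so the value there is reset to 0 to keep it
   nonnegative everywhere. *)
pose m' A := if `[< measurable A >] then m A else 0.
have m'E A : measurable A -> m' A = m A by move=> mA; rewrite /m' asboolT.
have m'0 : m' set0 = 0 by rewrite m'E.
have m'ge0 A : 0 <= m' A by rewrite /m'; case: asboolP => // /mge0.
have m'add : semi_sigma_additive m'.
  move=> F mF tF mUF; rewrite m'E//.
  under eq_fun do under eq_bigr do rewrite m'E//.
  exact: madd.
pose M := isMeasure.Build _ _ _ m' m'0 m'ge0 m'add.
pose nu : {measure set T -> \bar R} := HB.pack m' M.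
by exists nu.
Qed.

(** The integral is built from suprema over simple functions, whose level sets are measurable;
    values on other sets never enter. *)
Lemma eq_integral_setfun m1 m2 D (f : T -> \bar R) :
  (forall A, measurable A -> m1 A = m2 A) ->
  \int[m1]_(x in D) f x = \int[m2]_(x in D) f x.
Proof.
move=> m12; rewrite /integral.
have E (h : {nnsfun T >-> R}) : sintegral m1 h = sintegral m2 h.
  by apply: eq_fsbigr => r _; rewrite m12.
by congr (ereal_sup _ - ereal_sup _); apply/seteqP; split => _ [h hf <-];
  exists h.
Qed.

Lemma eq_integrable_setfun m1 m2 D (f : T -> \bar R) :
  (forall A, measurable A -> m1 A = m2 A) ->
  integrable m1 D f = integrable m2 D f.
Proof.
by move=> m12; rewrite !integrable.unlock (eq_integral_setfun _ _ m12).
Qed.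

Lemma density_measure_agreeing nu (k : T -> \bar R) : (forall x, 0 <= k x) ->
  measurable_fun setT k ->
  exists nu', forall A, measurable A ->
    (nu' : {measure set T -> \bar R}) A = \int[nu]_(x in A) k x.
Proof.
move=> k0 mk; apply: measure_agreeing => [|A mA|F mF tF].
- exact: integral_set0.
- exact: integral_ge0.
- rewrite ge0_integral_bigcup//; last exact: measurable_funTS.
  by apply: is_cvg_nneseries => *; exact: integral_ge0.
Qed.

End MeasureGenerics.

Section CountableSupport.
Context (R : realType).
Local Open Scope ereal_scope.
Local Notation mR := (measurableTypeR R).
Implicit Types (S : set mR) (nu : {measure set mR -> \bar R}).

(** Meant for the spectral measure of a vector in the range of E(A). All integrals reduce to [A],
    where [|x| <= |p| + |q|], and [nu] is finite. *)
Lemma bounded_support nu (A : set mR) (p q : R) : measurable A ->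
  A `<=` [set x | (p <= x <= q)%R] -> nu (~` A) = 0 -> nu setT < +oo ->
  [/\ nu.-integrable setT (fun x : mR => x%:E),
    p%:E * nu setT <= \int[nu]_x x%:E,
    \int[nu]_x x%:E <= q%:E * nu setT &
    \int[nu]_x ((x : R) ^+ 2)%:E < +oo].
Proof.
move=> mA Apq nuA nuT.
have mAC : measurable (~` A) by exact: measurableC.
have AE : setT `\` ~` A = A by rewrite setTD setCK.
have nuE : nu setT = nu A.
  by rewrite -(setvU A) measureU//= ?nuA ?add0e// setICl.
have nufin : nu A \is a fin_num by rewrite -nuE ge0_fin_numE.
pose M := (`|p| + `|q|)%R.
have AM x : A x -> (`|x : R| <= M)%R.
  move=> /Apq /= /andP[px xq]; rewrite /M ler_norml.
  have := (ler_norm q, ler_norm (- p)%R, normr_ge0 p, normr_ge0 q).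
  by rewrite normrN => -[[[? ?] ?] ?]; apply/andP; split; lra.
have mid : measurable_fun setT (fun x : mR => x%:E).
  exact/measurable_EFinP/measurable_id.
have int : nu.-integrable setT (fun x : mR => x%:E).
  apply/integrableP; split => //.
  rewrite (ge0_negligible_integral mAC)//; last exact: measurableT_comp.
  rewrite AE; apply: (@le_lt_trans _ _ (\int[nu]_(x in A) (cst M%:E x))).
    apply: ge0_le_integral => //.
    by apply: measurableT_comp => //; exact: measurable_funTS.
  by rewrite integral_cst// lte_mul_pinfty// ?ltey_eq ?nufin// lee_fin addr_ge0.
have intA : nu.-integrable A (fun x : mR => x%:E).
  by apply: integrableS int.
have cA (r : R) : nu.-integrable A (cst r%:E).
  apply/integrableP; split => //.
  by under eq_integral do rewrite /= /cst; rewrite integral_cst// -ge0_fin_numE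
    ?fin_numM// mule_ge0.
split => //.
- rewrite (negligible_integral mAC)// AE nuE -integral_cst//.
  by apply: le_integral => // x /set_mem/Apq/andP[px _]; rewrite lee_fin.
- rewrite (negligible_integral mAC)// AE nuE -integral_cst//.
  by apply: le_integral => // x /set_mem/Apq/andP[_ px]; rewrite lee_fin.
- have mx2 : measurable_fun setT (fun x : mR => ((x : R) ^+ 2)%:E).
    by apply/measurable_EFinP; exact: measurable_funX.
  rewrite (ge0_negligible_integral mAC)//; last first.
    by move=> x _; rewrite lee_fin sqr_ge0.
  rewrite AE; apply: (@le_lt_trans _ _ (\int[nu]_(x in A) (cst (M ^+ 2)%:E x))).
    apply: ge0_le_integral => //.
    - by move=> x Ax; rewrite lee_fin sqr_ge0.
    - exact: measurable_funTS.
    - move=> x Ax /=; rewrite lee_fin -[leLHS]real_normK ?num_real//.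
      by rewrite lerXn2r ?nnegrE ?AM// addr_ge0.
  by rewrite integral_cst// lte_mul_pinfty// ?ltey_eq ?nufin// lee_fin sqr_ge0.
Qed.


(** The preimage of [Y] lies in [S] if [0] is not in [Y]; otherwise its complement does. Subsets of
    [S] are countable, hence measurable. *)
Lemma measurable_fun_countable_support (S : set mR) (h : mR -> R) :
  countable S -> (forall x, ~ S x -> h x = 0%R) -> measurable_fun setT h.
Proof.
move=> cS h0 _ Y mY; rewrite setTI.
have mS (Z : set mR) : Z `<=` S -> measurable Z.
  move=> ZS; apply: countable_measurable; first exact: measurable_set1.
  exact: sub_countable (subset_card_le ZS) cS.
have [Y0|Y0] := pselect (Y 0%R).
  rewrite -[X in measurable X]setCK; apply: measurableC; apply: mS => x /= Yhx.
  by apply: contrapT => /h0 hx; apply: Yhx; rewrite hx.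
apply: mS => x /= Yhx; apply: contrapT => /h0 hx; apply: Y0.
by rewrite -hx.
Qed.

Lemma integral_countable_support nu S (g : mR -> \bar R) :
  countable S -> nu (~` S) = 0 -> (forall x, 0 <= g x) ->
  measurable_fun setT g ->
  \int[nu]_x g x = \esum_(x in S) (g x * nu [set x]).
Proof.
move=> cS nuS g0 mg.
have m1 (x : mR) : measurable [set x] by exact: measurable_set1.
have mS : measurable S by exact: countable_measurable.
rewrite (ge0_negligible_integral (measurableC mS))// setTD setCK.
have /countable_injP[c cinj] := cS.
(* The fibres of an injection of [S] into [nat] are empty or singletons, so they cut the integral
   into a countable sum over atoms. *)
pose F n : set mR := [set x | S x /\ c x = n].
have SF : S = \bigcup_n F n.
  by apply/seteqP; split => [x Sx|x [n _ []]//]; exists (c x).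
have tF : trivIset setT F.
  by apply/trivIsetP => i j _ _ ij; apply/seteqP; split=> x //= -[[_ xi] [_ xj]];
    move: ij; rewrite -xi -xj eqxx.
have F01 n : F n = set0 \/ exists x, F n = [set x].
  have [->|/set0P[x Fx]] := eqVneq (F n) set0; [by left|right; exists x].
  apply/seteqP; split => y /=; last by move=> ->.
  by case: Fx => Sx xn [Sy yn]; apply: cinj; rewrite ?mem_set// yn.
have mF n : measurable (F n) by case: (F01 n) => [->|[x ->]].
rewrite {1 2}SF ge0_integral_bigcup//; last by exact: measurable_funTS.
rewrite esum_bigcupT//; last by move=> x; rewrite mule_ge0.
rewrite nneseries_esumT; last by move=> n; exact: integral_ge0.
apply: eq_esum => n _; case: (F01 n) => [->|[x ->]].
  by rewrite integral_set0 esum_set0.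
rewrite esum_set1 ?mule_ge0//; transitivity (\int[nu]_(y in [set x]) cst (g x) y).
  by apply: eq_integral => y /set_mem ->.
by rewrite integral_cst.
Qed.

Lemma esum_exchange (T1 T2 : choiceType) (A : set T1) (B : set T2)
    (f : T1 -> T2 -> \bar R) : (forall i j, 0 <= f i j) ->
  \esum_(i in A) \esum_(j in B) f i j = \esum_(j in B) \esum_(i in A) f i j.
Proof.
move=> f0; rewrite !esum_esum//.
rewrite (@reindex_esum _ _ _ (A `*`` (fun=> B)) (B `*`` (fun=> A))
  (fun p => (p.2, p.1)))//.
split => [[i j] []//|[i1 j1] [i2 j2] _ _ [-> ->]//|[j i] [Bj Ai]].
by exists (i, j).
Qed.

(** Countable additivity is the exchange of two nonnegative sums, one over the atoms and one over
    the sets. *)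
Lemma point_masses_measure S :
  exists nu, forall A, measurable A -> nu A = point_masses (S : set R) A.
Proof.
apply: measure_agreeing => [|A mA|F mF tF].
- by rewrite /point_masses esum1// => x _; rewrite diracE in_set0.
- by apply: esum_ge0 => x _; rewrite diracE lee_fin.
- have pm0 (i : nat) : 0 <= point_masses (S : set R) (F i).
    by apply: esum_ge0 => x _; rewrite diracE lee_fin.
  rewrite [X in _ --> X](_ : _ = \sum_(i <oo) point_masses (S : set R) (F i)).
    by apply: is_cvg_nneseries.
  rewrite nneseries_esumT// esum_exchange; last by move=> *; rewrite diracE lee_fin.
  apply: eq_esum => x _; rewrite -nneseries_esumT; last first.
    by move=> *; rewrite diracE lee_fin.
  by rewrite measure_bigcup//; apply: eq_eseriesl => k; rewrite in_setT.
Qed.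

Lemma point_masses1 S (x : R) : S x -> point_masses S [set x] = 1.
Proof.
move=> Sx; rewrite /point_masses.
rewrite (esumID [set x])// [X in X + _](_ : _ = 1); last first.
  rewrite (_ : S `&` [set x] = [set x]) ?esum_set1 ?diracE ?lee_fin//.
    by rewrite mem_set.
  by apply/seteqP; split => [y []//|y ->].
rewrite esum1 ?adde0// => y [_ /= yx]; rewrite diracE memNset//.
Qed.

Lemma point_massesC S : point_masses S (~` S) = 0.
Proof. by rewrite /point_masses esum1// => y Sy; rewrite diracE memNset. Qed.

(** Since [nu] is the counting measure on [S], each [nu_ n] has the density [x |-> nu_ n [set x]]
    with respect to it. This density is at most 1 and tends to 1 on [S], so dominated convergence
    applies with the bound [|g|]. *)
Lemma cvg_integral_countable_support S nu
    (nu_ : nat -> {measure set mR -> \bar R}) (g : mR -> R) :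
  countable S -> nu (~` S) = 0 -> (forall x, S x -> nu [set x] = 1) ->
  (forall n, nu_ n (~` S) = 0) -> (forall n x, S x -> nu_ n [set x] <= 1) ->
  (forall x, S x -> nu_ n [set x] @[n --> \oo] --> 1) ->
  nu.-integrable setT (EFin \o g) ->
  (forall n, (nu_ n).-integrable setT (EFin \o g)) /\
  \int[nu_ n]_x (g x)%:E @[n --> \oo] --> \int[nu]_x (g x)%:E.
Proof.
move=> cS nuS nu1 nu_S nu_le1 nu_cvg ig.
have m1 (x : mR) : measurable [set x] by exact: measurable_set1.
have mS : measurable S by exact: countable_measurable.
have mg : measurable_fun setT g by apply/measurable_EFinP; exact: measurable_int ig.
pose h n (x : mR) : R := if `[< S x >] then fine (nu_ n [set x]) else 0%R.
have hE n x : S x -> (h n x)%:E = nu_ n [set x].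
  move=> Sx; rewrite /h asboolT// fineK// ge0_fin_numE//.
  by rewrite (le_lt_trans (nu_le1 n x Sx))// ltry.
have h0 n x : (0 <= h n x)%R by rewrite /h; case: asboolP => // _; exact: fine_ge0.
have h1 n x : (h n x <= 1)%R.
  by case: (pselect (S x)) => [Sx|nS]; [rewrite -lee_fin hE ?nu_le1
    |rewrite /h asboolF].
have mh n : measurable_fun setT (h n).
  by apply: measurable_fun_countable_support cS _ => x nSx; rewrite /h asboolF.
have mgh n : measurable_fun setT (fun x => (g x * h n x)%R) by exact: measurable_funM.
have int_h n (f : mR -> R) : (forall x, 0 <= f x)%R -> measurable_fun setT f ->
    \int[nu_ n]_x (f x)%:E = \int[nu]_x (f x * h n x)%:E.
  move=> f0 mf; rewrite !(integral_countable_support cS)//.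
  - apply: eq_esum => x Sx; rewrite nu1// mule1 EFinM hE//.
  - by move=> x; rewrite lee_fin mulr_ge0.
  - by apply/measurable_EFinP; exact: measurable_funM.
  - exact/measurable_EFinP.
have mabs (f : mR -> R) : measurable_fun setT f ->
  measurable_fun setT (fun x => `|f x|%R) by move=> mf; exact: measurableT_comp.
have igh n : nu.-integrable setT (fun x => (g x * h n x)%:E).
  apply: le_integrable ig => //; first exact/measurable_EFinP.
  move=> x _; rewrite !abse_EFin lee_fin normrM [`|h n x|%R]ger0_norm//.
  by rewrite ler_piMr.
have ig_ n : (nu_ n).-integrable setT (EFin \o g).
  apply/integrableP; split; first exact/measurable_EFinP.
  rewrite (int_h n (fun x => `|g x|%R))//; last exact: mabs.
  have /integrableP[_] := igh n; apply: le_lt_trans.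
  apply: ge0_le_integral => //=.
  - by move=> x _; rewrite lee_fin mulr_ge0.
  - by apply/measurable_EFinP; apply: measurable_funM => //; exact: mabs.
  - by apply/measurable_EFinP; exact: mabs.
  - by move=> x _; rewrite lee_fin normrM [`|h n x|%R]ger0_norm.
split => //.
(* [int_h] covers nonnegative functions only. As [h n >= 0], the positive and negative parts of
   [g * h n] are those of [g] multiplied by [h n]. *)
have int_gh n : \int[nu_ n]_x (g x)%:E = \int[nu]_x (g x * h n x)%:E.
  rewrite integralE [RHS]integralE; congr (_ - _).
    have E (m : {measure set mR -> \bar R}) (f : mR -> R) :
        \int[m]_x ((fun x => (f x)%:E)^\+ x) =
        \int[m]_x (Num.max (f x) 0%R)%:E.
      by apply: eq_integral => x _; rewrite funeposE EFin_max.
    rewrite E int_h ?E//.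
    - by apply: eq_integral => x _; rewrite maxr_pMl// mul0r.
    - by move=> x; rewrite le_max lexx orbT.
    - exact: measurable_maxr.
  have E (m : {measure set mR -> \bar R}) (f : mR -> R) :
      \int[m]_x ((fun x => (f x)%:E)^\- x) =
      \int[m]_x (Num.max (- f x) 0%R)%:E.
    by apply: eq_integral => x _; rewrite funenegE EFin_max.
  rewrite E int_h ?E//.
  - by apply: eq_integral => x _; rewrite maxr_pMl// mul0r mulNr.
  - by move=> x; rewrite le_max lexx orbT.
  - by apply: measurable_maxr => //; exact: measurableT_comp.
under eq_fun do rewrite int_gh.
have [] := @dominated_convergence _ mR R nu setT measurableT
  (fun n x => (g x * h n x)%:E) (EFin \o g) (fun x => `|g x|%:E).
- by move=> n; exact/measurable_EFinP.
- exact/measurable_EFinP.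
(* Pointwise convergence may fail only off [S], where [h n] vanishes identically, and that set is
   [nu]-null. *)
- exists (~` S); split => //; first exact: measurableC.
  move=> x /= nx Sx; apply: nx => _.
  apply: cvg_EFin; first by near=> n.
  rewrite -[X in _ --> X]mulr1; apply: cvgM; first exact: cvg_cst.
  have := nu_cvg x Sx; under eq_fun do rewrite -hE//.
  by move=> /fine_cvgP[].
- exact: integrable_abse ig.
- apply: aeW => x n _; rewrite abse_EFin lee_fin normrM [`|h n x|%R]ger0_norm//.
  by rewrite ler_piMr.
by [].
Unshelve. all: end_near. Qed.

End CountableSupport.

(** * Projection-valued measures and spectral calculus *)

Section ProjectionValuedMeasure.
Context (R : realType) (E : set (measurableTypeR R) -> cseq R -> cseq R).
Context (pvmE : projection_valued_measure E).
Local Notation mR := (measurableTypeR R).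
Implicit Types (A B : set mR) (u v : cseq R).

Lemma pvm_l2 A u : measurable A -> l2 u -> l2 (E A u).
Proof. by case: pvmE => H _ _ mA; case: (H A mA) => h _ _ _; exact: h. Qed.

Lemma pvmD A u v : measurable A -> l2 u -> l2 v -> E A (u + v) = E A u + E A v.
Proof.
case: pvmE => H _ _ mA lu lv; case: (H A mA) => _ h _ _.
by have := h 1 u v lu lv; rewrite !scale1r.
Qed.

Lemma pvmZ A z u : measurable A -> l2 u -> E A (z *: u) = z *: E A u.
Proof.
case: pvmE => H _ _ mA lu; case: (H A mA) => _ h _ _.
have h0 : E A 0 = 0.
  have := h 1 0 0 l2_0 l2_0; rewrite !scale1r addr0 => e.
  by apply: (@addrI _ (E A 0)); rewrite -e addr0.
by have := h z u 0 lu l2_0; rewrite h0 !addr0.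
Qed.

Lemma pvmN A u : measurable A -> l2 u -> E A (- u) = - E A u.
Proof. by move=> mA lu; rewrite -scaleN1r pvmZ// scaleN1r. Qed.

Lemma pvmB A u v : measurable A -> l2 u -> l2 v -> E A (u - v) = E A u - E A v.
Proof. by move=> mA lu lv; rewrite pvmD// ?pvmN//; exact: l2N. Qed.

Lemma pvm_idem A u : measurable A -> l2 u -> E A (E A u) = E A u.
Proof. by case: pvmE => H _ _ mA; case: (H A mA) => _ _ h _; exact: h. Qed.

Lemma pvm_sym A u v : measurable A -> l2 u -> l2 v ->
  rinner (E A u) v = rinner u (E A v).
Proof.
move=> mA lu lv; rewrite -!Re_inner//; [|exact: pvm_l2..].
by case: pvmE => H _ _; case: (H A mA) => _ _ _ ->.
Qed.

Lemma pvm_rinner A u : measurable A -> l2 u ->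
  rinner u (E A u) = rinner (E A u) (E A u).
Proof. by move=> mA lu; rewrite pvm_sym ?pvm_idem//; exact: pvm_l2. Qed.

Lemma pvmT u : l2 u -> E setT u = u.
Proof. by case: pvmE => _ + _; apply. Qed.

Lemma pvm_sigma_additive (F : nat -> set mR) u :
  (forall i, measurable (F i)) -> trivIset setT F -> l2 u ->
  l2_cvg (fun n => \sum_(0 <= i < n) E (F i) u) (E (\bigcup_i F i) u).
Proof. by case: pvmE => _ _ + mF tF; apply. Qed.

Lemma l2_cvg_near (s : nat -> cseq R) u : (\forall n \near \oo, s n = u) ->
  l2_cvg s u.
Proof.
move=> su; rewrite /l2_cvg; apply: cvg_near_cst.
near=> n; have -> : s n = u by near: n.
by rewrite subrr sqnormE ?rinner0l//; exact: l2_0.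
Unshelve. all: end_near. Qed.

(** In the decomposition of the empty set into empty sets, consecutive partial sums differ by
    [E set0 u] and have the same limit. Paired with [E set0 u], this gives [r = r + r] for its
    squared norm [r]. *)
Lemma pvm0 u : l2 u -> E set0 u = 0.
Proof.
move=> lu; have lE := pvm_l2 measurable0 lu.
have tF : trivIset setT (fun _ : nat => set0 : set mR).
  by move=> i j _ _ [x []].
have := pvm_sigma_additive (fun=> measurable0) tF lu.
rewrite bigcup0// => H.
have ls n : l2 (\sum_(0 <= i < n) E set0 u).
  by elim/big_ind : _ => //; [exact: l2_0|move=> *; exact: l2D].
apply: rinner_eq0 => //; set r := rinner _ _.
have rl := l2_cvg_rinner lE ls lE H.
have rl1 : rinner (E set0 u) (\sum_(0 <= i < n.+1) E set0 u) @[n --> \oo] --> r.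
  by move: rl; rewrite -(cvg_shiftS _ _).
have rl2 : rinner (E set0 u) (\sum_(0 <= i < n.+1) E set0 u) @[n --> \oo] --> r + r.
  under eq_fun do rewrite big_nat_recr//= rinnerDr//.
  exact: cvgD rl (cvg_cst _).
have : r = r + r by exact: (cvg_unique _ rl1 rl2).
by move=> /eqP; rewrite -[X in X == _]addr0 (inj_eq (addrI r)) eq_sym => /eqP.
Qed.

Lemma pvmU A B u : measurable A -> measurable B -> A `&` B = set0 -> l2 u ->
  E (A `|` B) u = E A u + E B u.
Proof.
move=> mA mB AB lu.
have mF i : measurable (bigcup2 A B i) by case: i => [|[|i]] //=; exact: measurable0.
have tF : trivIset setT (bigcup2 A B).
  by rewrite -trivIset_bigcup2.
have := pvm_sigma_additive mF tF lu; rewrite bigcup2E => H.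
have ls n : l2 (\sum_(0 <= i < n) E (bigcup2 A B i) u).
  elim/big_ind : _ => [|*|i _]; [exact: l2_0|exact: l2D|exact: pvm_l2].
apply: (l2_cvg_unique ls _ _ H); first by apply: pvm_l2 => //; exact: measurableU.
  by apply: l2D; exact: pvm_l2.
apply: l2_cvg_near; exists 2%N => // -[|[|n]]//= _.
by rewrite !big_nat_recl//= addrA big1 ?addr0// => k _; exact: pvm0.
Qed.

Lemma pvmC A u : measurable A -> l2 u -> E (~` A) u = u - E A u.
Proof.
move=> mA lu; rewrite -[X in X - _](pvmT lu) -(setUv A) pvmU ?setICr//.
  by rewrite addrC addKr.
exact: measurableC.
Qed.

(** Let [v = E B u]. The projection E(A u B) sends [v] to [E A v + v], and equating
    [<v, E(A u B) v>] with the squared norm of that vector leaves [2 |E A v|^2 = 0]. *)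
Lemma pvm_disjoint A B u : measurable A -> measurable B -> A `&` B = set0 ->
  l2 u -> E A (E B u) = 0.
Proof.
move=> mA mB AB lu; set v := E B u.
have lv : l2 v by exact: pvm_l2.
have lEv : l2 (E A v) by exact: pvm_l2.
have mAB : measurable (A `|` B) by exact: measurableU.
have Bv : E B v = v by exact: pvm_idem.
have := pvm_rinner mAB lv; rewrite pvmU// Bv rinnerDD// rinnerDr// pvm_rinner//.
rewrite [rinner (E A v) v]rinnerC pvm_rinner// => H.
by apply: rinner_eq0 => //; lra.
Qed.

(** Split [A] along [B]: the part of [A] off [B] kills the range of [E B], and [A] meet [B] kills
    the range of the complementary projection. *)
Lemma pvmI A B u : measurable A -> measurable B -> l2 u ->
  E A (E B u) = E (A `&` B) u.
Proof.
move=> mA mB lu.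
have mAB : measurable (A `&` B) by exact: measurableI.
have mBC : measurable (~` B) by exact: measurableC.
have mABC : measurable (A `&` ~` B) by exact: measurableI.
have lEB : l2 (E B u) by exact: pvm_l2.
rewrite -[A in LHS](setIT A) -(setUv B) setIUr pvmU//; last first.
  by rewrite setIACA setICr setI0.
rewrite [X in _ + X]pvm_disjoint// ?addr0; last first.
  by rewrite -setIA setICl setI0.
have -> : E B u = u - E (~` B) u by rewrite pvmC// subKr.
rewrite pvmB// ?pvm_disjoint ?subr0//; last exact: pvm_l2.
by rewrite -setIA setICr setI0.
Qed.

Lemma scalar_measureE u A : measurable A -> l2 u ->
  scalar_measure E u A = (rinner u (E A u))%:E.
Proof. by move=> mA lu; rewrite /scalar_measure Re_inner//; exact: pvm_l2. Qed.

Lemma scalar_measure_measure u : l2 u ->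
  exists nu : {measure set mR -> \bar R}, forall A, measurable A ->
    nu A = scalar_measure E u A.
Proof.
move=> lu; apply: measure_agreeing => [|A mA|F mF tF].
- by rewrite scalar_measureE// pvm0// rinner0r.
- rewrite scalar_measureE// lee_fin pvm_rinner// rinner_ge0//; exact: pvm_l2.
- have mUF : measurable (\bigcup_i F i) by exact: bigcupT_measurable.
  rewrite scalar_measureE//.
  have ls n : l2 (\sum_(0 <= i < n) E (F i) u).
    elim/big_ind : _ => [|*|i _]; [exact: l2_0|exact: l2D|exact: pvm_l2].
  rewrite (_ : (fun n => _) =
      (fun n => (\sum_(0 <= i < n) rinner u (E (F i) u))%:E)); last first.
    by apply/funext => n; rewrite -sumEFin; apply: eq_bigr => i _;
      exact: scalar_measureE.
  apply: cvg_EFin; first exact: nearW.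
  rewrite (_ : _ \o _ = (fun n => rinner u (\sum_(0 <= i < n) E (F i) u))).
    apply: l2_cvg_rinner => //; first exact: pvm_l2.
    exact: pvm_sigma_additive.
  apply/funext => n /=; elim: n => [|n IH].
    by rewrite !big_geq// rinner0r.
  by rewrite !big_nat_recr//= rinnerDr ?IH//; exact: pvm_l2.
Qed.

End ProjectionValuedMeasure.

(** * Null sets by countable covers *)

Section NullSets.
Context (R : realType).
Local Notation mR := (measurableTypeR R).
Implicit Types nu : {measure set mR -> \bar R}.

Lemma null_bigcup nu (I : countType) (F : I -> set mR) :
  (forall i, measurable (F i)) -> (forall i, nu (F i) = 0%E) ->
  measurable (\bigcup_i F i) /\ nu (\bigcup_i F i) = 0%E.
Proof.
move=> mF F0.
pose G n := if unpickle n is Some i then F i else set0.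
have mG n : measurable (G n) by rewrite /G; case: unpickle.
have FG : \bigcup_i F i = \bigcup_n G n.
  apply/seteqP; split => x [].
    by move=> i _ Fix; exists (pickle i) => //; rewrite /G pickleK.
  by move=> n _; rewrite /G; case: unpickle => // i Fix; exists i.
have mUG : measurable (\bigcup_n G n) by exact: bigcupT_measurable.
rewrite FG; split => //.
apply/measure_negligible => //; apply: negligible_bigcup => n.
by exists (G n); split => //; rewrite /G; case: unpickle.
Qed.

(** Lindeloef argument: every point of [U] lies in a null interval with rational endpoints, and
    there are countably many of these. [U] itself need not be measurable, hence the measurable cover
    [V]. *)
Lemma locally_null nu (U : set R) :
  (forall x, U x -> exists2 e : R, 0 < e &
     forall A : set mR, measurable A ->
       A `<=` [set y | x - e <= y <= x + e] -> nu A = 0%E) ->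
  exists V : set mR, [/\ measurable V, U `<=` V & nu V = 0%E].
Proof.
move=> locU.
pose J (p : rat * rat) : set mR := `]ratr p.1, ratr p.2[%classic.
pose F p : set mR := if `[< nu (J p) = 0%E >] then J p else set0.
have mF p : measurable (F p).
  by rewrite /F; case: asboolP => // _; exact: measurable_itv.
have F0 p : nu (F p) = 0%E by rewrite /F; case: asboolP.
have [mUF UF0] := null_bigcup mF F0.
exists (\bigcup_p F p); split => // x Ux.
have [e e0 nux] := locU x Ux.
have xe : x - e < x by rewrite ltrBlDr ltrDl.
have ex : x < x + e by rewrite ltrDl.
have [q] := rat_in_itvoo xe; have [r] := rat_in_itvoo ex.
rewrite !in_itv/= => /andP[xr re] /andP[eq qx].
have J0 : nu (J (q, r)) = 0%E.
  apply: nux; first exact: measurable_itv.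
  by move=> y; rewrite /J/= in_itv/= => /andP[qy yr]; apply/andP; split; lra.
exists (q, r) => //; rewrite /F asboolT//.
by rewrite /J /= in_itv/= qx xr.
Qed.

End NullSets.

(** * The operator on spectral subspaces of bounded sets *)

Section SpectralCalculus.
Context (R : realType) (T : set (cseq R * cseq R)).
Context (E : set (measurableTypeR R) -> cseq R -> cseq R).
Context (Tsa : self_adjoint T) (ET : spectral_measure_of T E).
Local Notation mR := (measurableTypeR R).
Implicit Types (A B : set mR) (u v y z : cseq R) (p q c e : R).

Let pvmE : projection_valued_measure E. Proof. by case: ET. Qed.

Lemma sa_l2 u y : T (u, y) -> l2 u /\ l2 y.
Proof. by case: Tsa => -[+ _ _ _] _ _ => /(_ (u, y))/[apply]. Qed.

Lemma saD u v y z : T (u, y) -> T (v, z) -> T (u + v, y + z).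
Proof.
by case: Tsa => -[_ _ h _] _ _ Tu Tv; have := h 1 _ _ _ _ Tu Tv; rewrite !scale1r.
Qed.

Lemma saZ (k : R[i]^o) u y : T (u, y) -> T (k *: u, k *: y).
Proof.
case: Tsa => -[_ h0 h _] _ _ Tu.
by have := h k _ _ _ _ Tu h0; rewrite !addr0.
Qed.

Lemma saB u v y z : T (u, y) -> T (v, z) -> T (u - v, y - z).
Proof.
by move=> Tu /(saZ (-1)) Tv; have := saD Tu Tv; rewrite !scaleN1r.
Qed.

Lemma sa_sym u v y z : T (u, y) -> T (v, z) -> rinner u z = rinner y v.
Proof.
move=> Tu Tv; have [lu ly] := sa_l2 Tu; have [lv lz] := sa_l2 Tv.
rewrite -!Re_inner//; case: Tsa => _ _ TT; move: Tu.
by rewrite -{1}TT => -[_ _ /(_ _ _ Tv)] ->.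
Qed.

Section BoundedRange.
Context (A : set mR) (p q : R).
Context (mA : measurable A) (Apq : A `<=` [set x : R | p <= x <= q]).

(** The spectral measure of such a [u] is carried by [A], because the complementary projection sends
    [u] to [u - E A u = 0]. *)
Let spectral_support u : l2 u -> E A u = u ->
  exists nu : {measure set mR -> \bar R},
  [/\ forall B, measurable B -> nu B = (rinner u (E B u))%:E,
     forall B, measurable B -> nu B = scalar_measure E u B,
     nu setT = (rinner u u)%:E
   & nu (~` A) = 0%E].
Proof.
move=> lu Au; have [nu nuE] := scalar_measure_measure pvmE lu.
have nuE' B : measurable B -> nu B = (rinner u (E B u))%:E.
  by move=> mB; rewrite nuE// scalar_measureE.
exists nu; split => //; first by rewrite nuE'// pvmT.
by rewrite nuE' ?pvmC// ?Au ?subrr ?rinner0r//; exact: measurableC.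
Qed.

(** The domain of [T] is characterised by a finite second moment of the spectral measure, which is
    automatic when that measure is finite and carried by a bounded set. *)
Lemma bounded_range_dom u : l2 u -> E A u = u -> exists y, T (u, y).
Proof.
move=> lu Au; have [nu [_ nuE nuT nuA]] := spectral_support lu Au.
have nuoo : (nu setT < +oo)%E by rewrite nuT ltry.
have [_ _ _ nu2] := bounded_support mA Apq nuA nuoo.
case: ET => _ /(_ u lu)[_ h] _; apply: h; move: nu2.
by rewrite (eq_integral_setfun _ _ nuE).
Qed.

Lemma bounded_range_integral u y : E A u = u -> T (u, y) ->
  exists nu : {measure set mR -> \bar R},
  [/\ forall B, measurable B -> nu B = (rinner u (E B u))%:E,
    nu.-integrable setT (fun x : mR => x%:E),
    (\int[nu]_x x%:E = (rinner u y)%:E)%E,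
    p * rinner u u <= rinner u y & rinner u y <= q * rinner u u].
Proof.
move=> Au Tu; have [lu ly] := sa_l2 Tu.
have [nu [nuE' nuE nuT nuA]] := spectral_support lu Au.
have nuoo : (nu setT < +oo)%E by rewrite nuT ltry.
have [inu le1 le2 _] := bounded_support mA Apq nuA nuoo.
(* The integral is finite, so the [fine] in [spectral_measure_of] does not fall back to its default
   value. *)
have uy : (\int[nu]_x x%:E)%E = (rinner u y)%:E.
  rewrite -Re_inner//; case: ET => _ _ /(_ _ _ Tu) ->.
  by rewrite -(eq_integral_setfun _ _ nuE)/= fineK//; exact: integrable_fin_num.
by exists nu; split => //; rewrite -lee_fin -uy EFinM -nuT.
Qed.

End BoundedRange.

(* The spectral measure of u + v is the sum of those of u and v, so the
   quadratic form of T is additive on u + v and the cross term vanishes. *)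
Lemma disjoint_range_orthogonal A B p q p' q' u v y z :
  measurable A -> measurable B -> A `&` B = set0 ->
  A `<=` [set x : R | p <= x <= q] -> B `<=` [set x : R | p' <= x <= q'] ->
  E A u = u -> E B v = v -> T (u, y) -> T (v, z) -> rinner v y = 0.
Proof.
move=> mA mB AB Apq Bpq Au Bv Tu Tv.
have [lu ly] := sa_l2 Tu; have [lv lz] := sa_l2 Tv.
have BA : B `&` A = set0 by rewrite setIC.
have mAB : measurable (A `|` B) by exact: measurableU.
have Auv : E (A `|` B) (u + v) = u + v.
  have Bu : E B u = 0 by rewrite -Au pvm_disjoint.
  have Av : E A v = 0 by rewrite -Bv pvm_disjoint.
  by rewrite pvmD// !pvmU// Au Bv Bu Av addr0 add0r.
have ABpq : A `|` B `<=` [set x : R | Num.min p p' <= x <= Num.max q q'].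
  by move=> x /= [/Apq|/Bpq] /= /andP[? ?]; rewrite ge_min le_max;
    apply/andP; split; apply/orP; tauto.
have [nu [nuE inu nuI _ _]] := bounded_range_integral mA Apq Au Tu.
have [nv [nvE inv nvI _ _]] := bounded_range_integral mB Bpq Bv Tv.
have [nw [nwE inw nwI _ _]] :=
  bounded_range_integral mAB ABpq Auv (saD Tu Tv).
(* The cross terms [<u, E C v>] and [<v, E C u>] vanish, because [v] is in the range of [E B] and
   [u] in that of [E A], with [A] and [B] disjoint. *)
have nwD C : measurable C -> nw C = measure_add nu nv C.
  move=> mC; rewrite measure_addE nuE// nvE// nwE// -EFinD; congr EFin.
  have lEu := pvm_l2 pvmE mC lu; have lEv := pvm_l2 pvmE mC lv.
  have uv0 : rinner u (E C v) = 0.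
    have mCB : measurable (C `&` B) by exact: measurableI.
    have -> : E C v = E (C `&` B) v by rewrite -[in LHS]Bv pvmI.
    have lCB : l2 (E (C `&` B) v) by exact: pvm_l2.
    rewrite -Au pvm_sym// pvm_disjoint ?rinner0r//.
    by rewrite setICA AB setI0.
  have vu0 : rinner v (E C u) = 0 by rewrite -pvm_sym// rinnerC.
  rewrite pvmD// rinnerDl//; last exact: l2D.
  by rewrite !rinnerDr// uv0 vu0 addr0 add0r.
have mid : measurable_fun setT (fun x : mR => x%:E).
  exact/measurable_EFinP/measurable_id.
move: nwI; rewrite (eq_integral_setfun _ _ nwD) integral_measure_add//.
rewrite nuI nvI -EFinD => -[].
(* Expanding the form leaves [<u, z> + <v, y> = 0], and the two terms are equal by symmetry of
   [T]. *)
rewrite rinnerDl//; last exact: l2D.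
rewrite !rinnerDr// (sa_sym Tu Tv) [rinner y v]rinnerC.
by move=> H; lra.
Qed.

(** By orthogonality of disjoint ranges, [y] has no spectral mass on any bounded piece of the
    complement of [A]; countably many pieces exhaust that complement. *)
Lemma bounded_range_invariant A p q u y : measurable A ->
  A `<=` [set x : R | p <= x <= q] -> E A u = u -> T (u, y) -> E A y = y.
Proof.
move=> mA Apq Au Tu; have [lu ly] := sa_l2 Tu.
have [nu nuE] := scalar_measure_measure pvmE ly.
(* The truncation to [[-k, k]] puts [E (B k) y] in the domain of [T]. *)
pose B (k : nat) : set mR := ~` A `&` `[- k%:R, k%:R]%classic.
have mAC : measurable (~` A) by exact: measurableC.
have mB k : measurable (B k) by apply: measurableI => //; exact: measurable_itv.
have Bk k : B k `<=` [set x : R | - k%:R <= x <= k%:R].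
  by move=> x [_] /=; rewrite in_itv.
have nuB k : nu (B k) = 0%E.
  have lw : l2 (E (B k) y) by exact: pvm_l2.
  have Bw : E (B k) (E (B k) y) = E (B k) y by exact: pvm_idem.
  have [z Tw] := bounded_range_dom (mB k) (@Bk k) lw Bw.
  rewrite nuE// scalar_measureE// rinnerC.
  rewrite (disjoint_range_orthogonal mA (mB k) _ Apq (@Bk k) Au Bw Tu Tw)//.
  by rewrite /B setIA setICr set0I.
have [mUB UB0] := null_bigcup mB nuB.
have UBA : \bigcup_k B k = ~` A.
  apply/seteqP; split => [x [k _ []]//|x nAx].
  exists (Num.truncn `|x|).+1 => //; split => //=.
  by rewrite in_itv/= -ler_norml ltW// truncnS_gt.
move: UB0; rewrite UBA nuE// scalar_measureE// => -[yA0].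
have : E (~` A) y = 0.
  by apply: rinner_eq0; [exact: pvm_l2|rewrite -pvm_rinner].
by rewrite pvmC// => /eqP; rewrite subr_eq0 => /eqP.
Qed.

(* A symmetric operator is bounded by its numerical radius. *)
Lemma bounded_range_norm A c e u y : 0 < e -> measurable A ->
  A `<=` [set x : R | c - e <= x <= c + e] -> E A u = u -> T (u, y) ->
  rinner (y - c%:C%C *: u) (y - c%:C%C *: u) <= e ^+ 2 * rinner u u.
Proof.
move=> e0 mA Ace Au Tu; have [lu ly] := sa_l2 Tu.
have lcu : l2 (c%:C%C *: u) by exact: l2Z.
have [s sE] : exists s, s = y - c%:C%C *: u by exists (y - c%:C%C *: u).
rewrite -sE; have ls : l2 s by rewrite sE; exact: l2B.
have As : E A s = s.
  by rewrite sE pvmB// pvmZ// Au (bounded_range_invariant mA Ace Au Tu).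
have [z Ts] := bounded_range_dom mA Ace ls As.
have [_ lz] := sa_l2 Ts.
(* [y + t z] is the image of [u + t s] under [T], so the bounds of [A] control the quadratic form
   along the whole line. *)
have Q (t : R) : (c - e) * rinner (u + t%:C%C *: s) (u + t%:C%C *: s) <=
    rinner (u + t%:C%C *: s) (y + t%:C%C *: z) <=
    (c + e) * rinner (u + t%:C%C *: s) (u + t%:C%C *: s).
  have lts : l2 (t%:C%C *: s) by exact: l2Z.
  have Auts : E A (u + t%:C%C *: s) = u + t%:C%C *: s.
    by rewrite pvmD// pvmZ// Au As.
  have Tut := saD Tu (saZ t%:C%C Ts).
  have [_ [_ _ _ -> ->]] := bounded_range_integral mA Ace Auts Tut.
  by [].
have Q' (t : R) : `|rinner u y + 2 * t * rinner y s + t ^+ 2 * rinner s z -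
    c * (rinner u u + 2 * t * rinner u s + t ^+ 2 * rinner s s)| <=
    e * (rinner u u + 2 * t * rinner u s + t ^+ 2 * rinner s s).
  have := Q t; have lts : l2 (t%:C%C *: s) by exact: l2Z.
  have ltz : l2 (t%:C%C *: z) by exact: l2Z.
  rewrite !rinnerDD//. rewrite rinnerDl ?rinnerDr//; [|exact: l2D..].
  rewrite !rinnerZl// !rinnerZr// (sa_sym Tu Ts) [rinner s y]rinnerC.
  by move=> /andP[? ?]; rewrite ler_norml; apply/andP; split; lra.
have ss : rinner s s = rinner y s - c * rinner u s.
  by rewrite {1}sE rinnerBl// rinnerZl.
(* Polarisation: subtracting the bounds at [t = 1/e] and [t = -1/e] leaves
   [4 t |s|^2 <= 2 e |u|^2 + 2 e t^2 |s|^2]. With [e t = 1] the last term is [2 t |s|^2] and is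
   absorbed. *)
have := Q' e^-1; have := Q' (- e^-1); rewrite !ler_norml => /andP[H1 _] /andP[_ H2].
have ie0 : 0 < e^-1 by rewrite invr_gt0.
have iee : e * e^-1 = 1 by rewrite divff// gt_eqF.
have H : 4 * e^-1 * rinner s s <= 2 * e * rinner u u + 2 * e^-1 * rinner s s.
  have -> : 2 * e^-1 * rinner s s = 2 * e * (e^-1 ^+ 2 * rinner s s).
    by rewrite -[e^-1 in LHS]mul1r -iee; ring.
  by rewrite [in leLHS]ss; move: H1 H2; lra.
have {}H : e^-1 * rinner s s <= e * rinner u u by lra.
by rewrite expr2 -mulrA -ler_pdivrMl.
Qed.

Lemma resolvent_locally_null (x : R) : resolvent_set T x%:C%C ->
  exists2 e : R, 0 < e & forall A, measurable A ->
    A `<=` [set y : R | x - e <= y <= x + e] ->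
    forall u, l2 u -> E A u = 0.
Proof.
(* [N] is a positive bound for [M]. Below, [e <= 1] gives [e^2 <= e], and [e <= 1 / (2 N)] gives
   [N e <= 1/2], so that [|v|^2 <= |v|^2 / 2]. *)
move=> [inj [M MT]]; pose N := `|M| + 1.
have N0 : 0 < N by rewrite ltr_wpDl.
pose e := Num.min 1 (2 * N)^-1.
have e0 : 0 < e by rewrite lt_min ltr01 invr_gt0 mulr_gt0.
have e1 : e <= 1 by rewrite ge_min lexx.
have eN : e <= (2 * N)^-1 by rewrite ge_min lexx orbT.
exists e => // A mA Axe u lu.
have lv : l2 (E A u) by exact: pvm_l2.
have Av : E A (E A u) = E A u by exact: pvm_idem.
set v := E A u in lv Av *.
have [y Tv] := bounded_range_dom mA Axe lv Av.
have [_ ly] := sa_l2 Tv.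
have ls : l2 (y - x%:C%C *: v) by apply: l2B => //; exact: l2Z.
have [w [Tw]] := MT _ ls; have [lw _] := sa_l2 Tw.
(* The solution [w] supplied by the resolvent is [v] itself, since the difference lies in the kernel
   of [T - x]; the bound by [M] thus applies to [v]. *)
have Twv : T (w - v, (x%:C%C : R[i]^o) *: (w - v)).
  have := saB Tw Tv; rewrite (_ : _ - y = x%:C%C *: (w - v))//.
  by rewrite scalerBr [y - _ + _]addrC addrA addrAC addrK.
have /eqP := inj _ Twv; rewrite subr_eq0 => /eqP ->.
rewrite !sqnormE// -EFinM lee_fin => H.
have B := bounded_range_norm e0 mA Axe Av Tv.
apply: rinner_eq0 => //; apply/eqP; rewrite eq_le rinner_ge0// andbT.
have r0 := rinner_ge0 lv; have s0 := rinner_ge0 ls.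
have MN : M <= N by rewrite /N; have := ler_norm M; lra.
have H1 : rinner v v <= N * (e * rinner v v).
  apply: le_trans H _; apply: le_trans (ler_wpM2r s0 MN) _.
  rewrite ler_pM2l//; apply: le_trans B _; rewrite expr2 ler_wpM2r//.
  by rewrite ler_piMr// ltW.
have H2 : N * e <= 2^-1.
  rewrite -(ler_pM2l (x := 2))// mulrA divff// -ler_pdivlMl ?mulr_gt0//.
  by rewrite mulr1.
have : N * (e * rinner v v) <= 2^-1 * rinner v v by rewrite mulrA ler_wpM2r.
by lra.
Qed.

(** For [v = E A u], invariance and symmetry give [<v, T v> = x |v|^2]. This form also lies between
    the bounds of [A] times [|v|^2], and half the distance from [x] to [y] keeps [x] outside
    them. *)
Lemma eigenvector_locally_null (u : cseq R) (x y : R) : y != x ->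
  T (u, x%:C%C *: u) ->
  exists2 e : R, 0 < e & forall A, measurable A ->
    A `<=` [set y' : R | y - e <= y' <= y + e] -> E A u = 0.
Proof.
move=> yx Tu; have [lu _] := sa_l2 Tu.
have d0 : 0 < `|x - y| by rewrite normr_gt0 subr_eq0 eq_sym.
exists (`|x - y| / 2); first by rewrite divr_gt0.
move=> A mA Aye.
have lv : l2 (E A u) by exact: pvm_l2.
have Av : E A (E A u) = E A u by exact: pvm_idem.
have [z Tv] := bounded_range_dom mA Aye lv Av.
have [_ lz] := sa_l2 Tv.
have Az := bounded_range_invariant mA Aye Av Tv.
have vz : rinner (E A u) z = x * rinner (E A u) (E A u).
  rewrite pvm_sym// Az (sa_sym Tu Tv) rinnerZl//.
  by rewrite pvm_rinner.
have [_ [_ _ _]] := bounded_range_integral mA Aye Av Tv.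
rewrite vz => H1 H2; apply: rinner_eq0 => //; have r0 := rinner_ge0 lv.
apply/eqP; rewrite eq_le r0 andbT leNgt; apply/negP => r1.
have : (y - `|x - y| / 2) <= x by rewrite -(ler_pM2r r1).
have : x <= (y + `|x - y| / 2) by rewrite -(ler_pM2r r1).
by clear - d0; case: (ger0P (x - y)) d0 => *; lra.
Qed.

(** The spectral measure of [u] is locally null away from [x], hence null on the complement of
    [x]. *)
Lemma eigenvector_range (u : cseq R) (x : R) :
  T (u, x%:C%C *: u) -> E [set x] u = u.
Proof.
move=> Tu; have [lu _] := sa_l2 Tu.
have [nu nuE] := scalar_measure_measure pvmE lu.
have mx : measurable ([set x] : set mR) by exact: measurable_set1.
have [V [mV xV V0]] : exists V : set mR,
    [/\ measurable V, ~` [set x] `<=` V & nu V = 0%E].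
  apply: locally_null => y yx; have {}yx : y != x by exact/eqP.
  have [e e0 H] := eigenvector_locally_null yx Tu.
  exists e => // A mA /(H A mA) Au.
  by rewrite nuE// scalar_measureE// Au rinner0r.
have mC := measurableC mx.
have : nu (~` [set x]) = 0%E.
  by apply/eqP; rewrite -measure_le0 -V0 le_measure// mem_set.
rewrite nuE// scalar_measureE// pvm_rinner// => -[].
move=> /(rinner_eq0 (pvm_l2 pvmE mC lu)).
by rewrite pvmC// => /eqP; rewrite subr_eq0 => /eqP.
Qed.

End SpectralCalculus.

Section RangeEigenvector.
Context (R : realType) (T : set (cseq R * cseq R)).
Context (E : set (measurableTypeR R) -> cseq R -> cseq R).
Context (Tsa : self_adjoint T) (ET : spectral_measure_of T E).

(** The singleton fits in [[x - e, x + e]] for every [e > 0], so [|T u - x u|^2 <= e^2 |u|^2] for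
    all such [e]. *)
Lemma range_eigenvector (u : cseq R) (x : R) : l2 u -> E [set x] u = u ->
  T (u, (x%:C%C : R[i]^o) *: u).
Proof.
move=> lu xu.
have mx : measurable ([set x] : set (measurableTypeR R)).
  exact: measurable_set1.
have xe e : 0 <= e -> [set x] `<=` [set y | x - e <= y <= x + e].
  by move=> e0 y /= ->; rewrite lerBlDr lerDl e0.
have [y Ty] := bounded_range_dom ET mx (xe 0 (lexx 0)) lu xu.
have [_ ly] := sa_l2 Tsa Ty.
have ls : l2 (y - x%:C%C *: u) by apply: l2B => //; exact: l2Z.
suff /(rinner_eq0 ls)/eqP : rinner (y - x%:C%C *: u) (y - x%:C%C *: u) = 0.
  by rewrite subr_eq0 => /eqP <-.
apply/eqP; rewrite eq_le rinner_ge0// andbT; apply/ler_addgt0Pr => d d0.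
rewrite add0r; have r0 := rinner_ge0 lu.
have r1 : 0 < rinner u u + 1 by rewrite ltr_wpDl.
pose e := Num.min 1 (d / (rinner u u + 1)).
have e0 : 0 < e by rewrite lt_min ltr01 divr_gt0.
have e1 : e <= 1 by rewrite ge_min lexx.
have ed : e <= d / (rinner u u + 1) by rewrite ge_min lexx orbT.
have := bounded_range_norm Tsa ET e0 mx (xe e (ltW e0)) xu Ty.
move=> /le_trans; apply; apply: (@le_trans _ _ (e * (rinner u u + 1))).
  rewrite expr2 ler_pM// ?mulr_ge0 ?(ltW e0)// ?lerDl//.
  by rewrite ler_piMr// ltW.
by rewrite -ler_pdivlMr.
Qed.

End RangeEigenvector.

(** * Jacobi operators *)

Section Jacobi.
Context (R : realType) (a b : nat -> R).
Context (T : set (cseq R * cseq R)) (Tsa : self_adjoint T).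
Context (JT : jacobi_operator a b `<=` T).

(** The standard basis of [l2]; [delta 0] is [e0]. *)
Definition delta (n : nat) : cseq R := fun k => (k == n)%:R.

Lemma l2_finitely_supported (u : cseq R) : finitely_supported u -> l2 u.
Proof.
move=> [N uN]; apply/l2P; apply/cvg_ex.
exists (series (fun k => dot (u k) (u k)) N); apply: cvg_near_cst.
exists N => // n /= Nn; rewrite /series/= (big_cat_nat _ Nn)//=.
rewrite [X in _ + X]big_nat_cond [X in _ + X]big1 ?addr0// => i.
by rewrite andbT => /andP[Ni _]; rewrite uN// /dot !mul0r addr0.
Qed.

Lemma jacobi_finitely_supported (u : cseq R) : finitely_supported u ->
  finitely_supported (jacobi_action a b u).
Proof.
move=> [N uN]; exists N.+1 => -[//|n]; rewrite ltnS => Nn.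
by rewrite /jacobi_action !uN ?mulr0 ?addr0// ltnW// ltnW.
Qed.

Lemma jacobi_action_mem (u : cseq R) : finitely_supported u ->
  T (u, jacobi_action a b u).
Proof.
move=> fu; apply: JT; split; [exact: l2_finitely_supported|
  exact/l2_finitely_supported/jacobi_finitely_supported|].
exists (fun=> u), (fun=> jacobi_action a b u); split => [_||].
- by exists u.
- by apply: l2_cvg_near; exact: nearW.
- by apply: l2_cvg_near; exact: nearW.
Qed.

Lemma delta_finitely_supported n : finitely_supported (delta n).
Proof. by exists n.+1 => k nk; rewrite /delta gtn_eqF. Qed.

Lemma l2_delta n : l2 (delta n).
Proof. exact/l2_finitely_supported/delta_finitely_supported. Qed.

Lemma rinner_delta n (u : cseq R) : rinner (delta n) u = complex.Re (u n).
Proof.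
rewrite /rinner; apply/cvg_lim => //; apply: cvg_near_cst.
exists n.+1 => // k /= nk; rewrite /series/= big_mkord (bigD1 (Ordinal nk))//=.
rewrite /delta eqxx /dot/= mul1r mul0r addr0 big1 ?addr0// => i ni.
suff -> : (nat_of_ord i == n) = false by rewrite /= !mul0r addr0.
by apply: contraNF ni => /eqP ni; apply/eqP/val_inj.
Qed.

Lemma jacobi_action_delta n : jacobi_action a b (delta n) =
  (if n is m.+1 then (a m)%:C%C *: delta m else 0) + (b n)%:C%C *: delta n
    + (a n)%:C%C *: delta n.+1.
Proof.
apply/funext => k; rewrite /jacobi_action.
have -> : (delta n) = (fun j => (j == n)%:R) by [].
have E (z : R[i]^o) (u : cseq R) : (z *: u) k = z * u k by [].
have D (u v : cseq R) : (u + v) k = u k + v k by [].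
rewrite !D !E /delta.
(* The indicators let each coefficient index move between [k] and [n], which turns row entries of
   the symmetric matrix into column entries. *)
have -> : (if n is m.+1 then (a m)%:C%C *: (fun j => (j == m)%:R) else 0 : cseq R) k
  = (a k)%:C%C * (k.+1 == n)%:R.
  case: n => [|m]; first by rewrite mulr0.
  by rewrite E eqSS; case: eqP => [->//|_]; rewrite !mulr0.
have -> : (if k is m.+1 then (a m)%:C%C * (m == n)%:R else 0)
  = (a n)%:C%C * (k == n.+1)%:R.
  case: k E D => [|m] _ _; first by rewrite mulr0.
  by rewrite eqSS; case: eqP => [->//|_]; rewrite !mulr0.
have -> : (b k)%:C%C * (k == n)%:R = (b n)%:C%C * (k == n)%:R :> R[i].
  by case: eqP => [->//|_]; rewrite !mulr0.
by rewrite addrC [X in _ + X]addrC addrA.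
Qed.

(** Basis vectors lie in the domain of [T], so symmetry moves [T] from [u] to [delta n], where it
    acts as the matrix. *)
Lemma eigenvector_jacobi (u : cseq R) (x : R) : T (u, (x%:C%C : R[i]^o) *: u) ->
  forall n, x%:C%C * u n = jacobi_action a b u n.
Proof.
have H (v : cseq R) n : T (v, (x%:C%C : R[i]^o) *: v) ->
    complex.Re (x%:C%C * v n) = complex.Re (jacobi_action a b v n).
  move=> Tv; have [lv _] := sa_l2 Tsa Tv.
  have := sa_sym Tsa (jacobi_action_mem (delta_finitely_supported n)) Tv.
  rewrite rinner_delta => ->; rewrite jacobi_action_delta.
  have ld := l2_delta.
  have lZ (r : R) m : l2 ((r%:C%C : R[i]^o) *: delta m) by exact: l2Z.
  have l1 : l2 (if n is m.+1 then (a m)%:C%C *: delta m else 0).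
    by case: n => [|n]; [exact: l2_0|exact: lZ].
  rewrite rinnerDl// ?rinnerDl// ?rinnerZl// ?rinner_delta//; last exact: l2D.
  have ReZ (r : R) (z : R[i]) : complex.Re (r%:C%C * z) = r * complex.Re z.
    by case: z => z1 z2 /=; rewrite mul0r subr0.
  rewrite /jacobi_action !raddfD/= !ReZ; congr (_ + _ + _).
  by case: n {l1} => [|n]; rewrite ?rinner0l// rinnerZl// rinner_delta ReZ.
move=> Tu n; apply/eqP; rewrite eq_complex H// eqxx/=; apply/eqP.
(* [rinner] only sees real parts; imaginary parts come from the eigenvector [- i u]. *)
have Tiu : T ((- 'i)%C *: u, (x%:C%C : R[i]^o) *: ((- 'i)%C *: u)).
  by rewrite scalerA mulrC -scalerA; exact: saZ.
have JE : jacobi_action a b ((- 'i)%C *: u) n = (- 'i)%C * jacobi_action a b u n.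
  have E k : ((- 'i)%C *: u) k = (- 'i)%C * u k by [].
  rewrite /jacobi_action !E !mulrDr; congr (_ + _ + _); last by rewrite mulrCA.
    by case: n => [|n]; rewrite ?mulr0// E mulrCA.
  by rewrite mulrCA.
have Im_Re (z : R[i]) : complex.Re ((- 'i)%C * z) = complex.Im z.
  by case: z => z1 z2 /=; rewrite oppr0 mul0r add0r mulN1r opprK.
have := H _ n Tiu; rewrite JE (_ : (_ *: u) n = (- 'i)%C * u n)// mulrCA.
by rewrite !Im_Re.
Qed.

Lemma eigenvector_orthopoly (apos : forall n, 0 < a n) (u : cseq R) (x : R) :
  T (u, (x%:C%C : R[i]^o) *: u) ->
  forall n, u n = u 0%N * ((orthopoly a b n).[x])%:C%C.
Proof.
move=> Tu; have rec := eigenvector_jacobi Tu.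
have an0 n : (a n)%:C%C != 0 :> R[i] by rewrite (inj_eq (@complexI _)) gt_eqF.
(* The recurrence has order two, so the induction carries two consecutive indices. *)
suff H n : u n = u 0%N * ((orthopoly a b n).[x])%:C%C /\
           u n.+1 = u 0%N * ((orthopoly a b n.+1).[x])%:C%C.
  by move=> n; case: (H n).
elim: n => [|n [IH0 IH1]].
  split; first by rewrite hornerC mulr1.
  apply: (mulfI (an0 0%N)); have := rec 0%N; rewrite /jacobi_action add0r => H.
  have -> : (a 0%N)%:C%C * u 1%N = x%:C%C * u 0%N - (b 0%N)%:C%C * u 0%N.
    by rewrite H addrC addKr.
  rewrite /= hornerZ hornerD hornerX hornerN hornerC -mulrBl.
  rewrite [RHS]mulrCA -rmorphM mulVKf ?gt_eqF//= [RHS]mulrC.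
  by rewrite rmorphB.
split => //.
apply: (mulfI (an0 n.+1)); have := rec n.+1; rewrite /jacobi_action => H.
have -> : (a n.+1)%:C%C * u n.+2 =
    x%:C%C * u n.+1 - (a n)%:C%C * u n - (b n.+1)%:C%C * u n.+1.
  by rewrite H; ring.
rewrite IH0 IH1 [orthopoly a b n.+2]/= -/(orthopoly a b n.+1).
rewrite hornerZ hornerD hornerN hornerZ hornerM hornerD hornerX hornerN hornerC.
rewrite [RHS]mulrCA -rmorphM mulVKf ?gt_eqF//=.
set P1 := (orthopoly a b n.+1).[x]; set P0 := (orthopoly a b n).[x].
have -> : ((x - b n.+1) * P1 - a n * P0)%:C%C =
  (x%:C%C - (b n.+1)%:C%C) * P1%:C%C - (a n)%:C%C * P0%:C%C.
  by rewrite rmorphB !rmorphM rmorphB.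
by ring.
Qed.

Lemma horner_cd_kernel n (x : R) :
  cd_kernel a b n x x = (\sum_(0 <= j < n) orthopoly a b j ^+ 2).[x].
Proof. by rewrite horner_sum; apply: eq_bigr => j _; rewrite horner_exp expr2. Qed.

Lemma measurable_cd_kernel n : measurable_fun setT
  (fun x : measurableTypeR R => cd_kernel a b n x x).
Proof.
rewrite (_ : (fun x => _) =
  horner (\sum_(0 <= j < n) orthopoly a b j ^+ 2)); last first.
  by apply/funext => x; exact: horner_cd_kernel.
by apply: continuous_measurable_fun; exact: continuous_horner.
Qed.

Lemma cd_kernel_ge0 n (x : R) : 0 <= cd_kernel a b n x x.
Proof. by apply: sumr_ge0 => j _; rewrite -expr2 sqr_ge0. Qed.

End Jacobi.

(** * The spectral measure of [e0] for empty essential spectrum *)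

Section DiscreteSpectralMeasure.
Context (R : realType) (a b : nat -> R) (apos : forall n, 0 < a n).
Context (T : set (cseq R * cseq R)).
Context (E : set (measurableTypeR R) -> cseq R -> cseq R).
Context (Tsa : self_adjoint T) (JT : jacobi_operator a b `<=` T).
Context (ET : spectral_measure_of T E).
Context (Tess : essential_spectrum T = set0).
Local Notation mR := (measurableTypeR R).
Local Notation S := (real_spectrum T).

Let pvmE : projection_valued_measure E. Proof. by case: ET. Qed.

Lemma spectrum_discrete z : spectrum T z -> discrete_spectrum T z.
Proof.
move=> sz; apply: contrapT => nd.
have : essential_spectrum T z by split.
by rewrite Tess.
Qed.

(** Every point of the spectrum is discrete, hence isolated, and a set of reals has countably many
    isolated points. *)
Lemma countable_real_spectrum : countable S.
Proof.
apply: sub_countable (countable_isolated S); apply: subset_card_le => x Sx.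
split; first exact: mem_set.
have [_ + _ _] := spectrum_discrete Sx.
(* The positive complex radius is real, and the complex ball restricts to the real ball of radius
   [e1]. *)
move=> /nbhs_ballP[[e1 e2]]; rewrite /= ltcE/= => /andP[/eqP -> e0] H.
exists (ball x e1); first exact: nbhsx_ballx.
apply/seteqP; split => [y [xy Sy]|y ->]; last by split => //; exact: ballxx.
suff /complexI : y%:C%C = x%:C%C by [].
apply: H => //=; rewrite -ball_normE /= -rmorphB normc_def/= expr0n addr0.
by rewrite sqrtr_sqr ltcR.
Qed.

Lemma l2_e0 : l2 (e0 : cseq R).
Proof. exact: l2_delta. Qed.

Lemma null_compl_real_spectrum (nu : {measure set mR -> \bar R}) :
  (forall A, measurable A -> nu A = scalar_measure E e0 A) ->
  nu (~` S : set mR) = 0%E.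
Proof.
move=> nuE.
have mS : measurable (S : set mR).
  apply: countable_measurable countable_real_spectrum.
  exact: measurable_set1.
have [V [mV SV V0]] : exists V : set mR,
    [/\ measurable V, ~` S `<=` V & nu V = 0%E].
  apply: locally_null => x Sx.
  have rx : resolvent_set T x%:C%C by exact: contrapT.
  have [e e0 H] := resolvent_locally_null Tsa ET rx.
  exists e => // A mA /(H A mA) HA.
  by rewrite nuE// scalar_measureE ?HA ?rinner0r//; exact: l2_e0.
by apply/eqP; rewrite -measure_le0 -V0 le_measure// mem_set//; exact: measurableC.
Qed.

Lemma cd_kernelE n (x : R) : cd_kernel a b n x x =
  series (fun k => dot ((orthopoly a b k).[x])%:C%C ((orthopoly a b k).[x])%:C%C) n.
Proof. by apply: eq_bigr => k _; rewrite /dot/= mulr0 addr0. Qed.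

(** The eigenspace at [x] is spanned by [p], with [p 0 = 1], so [v = E [set x] e0] is a multiple of
    [p]. Then [1 = <p, e0> = <p, v> = |p|^2 r], where [r] is the mass at [x] and the kernels on the
    diagonal are the partial sums of [|p|^2]. *)
Lemma real_spectrum_mass (x : R) : S x ->
  exists r : R, [/\ scalar_measure E e0 [set x] = r%:E, 0 <= r,
    forall n, cd_kernel a b n x x * r <= 1 &
    cd_kernel a b n x x * r @[n --> \oo] --> (1 : R)].
Proof.
move=> /spectrum_discrete[_ _ [u [u0 Tu]] _].
have uP := eigenvector_orthopoly Tsa JT apos Tu.
have u00 : u 0%N != 0.
  apply: contra u0 => /eqP u00; apply/eqP/funext => n.
  by rewrite (uP n) u00 mul0r.
pose p : cseq R := fun n => ((orthopoly a b n).[x])%:C%C.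
have pE : p = ((u 0%N)^-1 : R[i]^o) *: u.
  apply/funext => n; rewrite (_ : (_ *: u) n = (u 0%N)^-1 * u n)//.
  by rewrite (uP n) mulKf.
have Tp : T (p, (x%:C%C : R[i]^o) *: p).
  by rewrite pE scalerA mulrC -scalerA; exact: saZ.
have [lp _] := sa_l2 Tsa Tp.
have mx : measurable ([set x] : set mR) by exact: measurable_set1.
have Ep := eigenvector_range Tsa ET Tp.
pose v := E [set x] e0.
have lv : l2 v by exact: pvm_l2 l2_e0.
have Ev : E [set x] v = v by apply: pvm_idem => //; exact: l2_e0.
have Tv := range_eigenvector Tsa ET lv Ev.
have vP : v = (v 0%N : R[i]^o) *: p.
  by apply/funext => n; rewrite (eigenvector_orthopoly Tsa JT apos Tv n).
pose r := complex.Re (v 0%N).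
have rE : rinner e0 v = r by exact: rinner_delta.
have p0 : rinner p e0 = 1.
  by rewrite rinnerC (rinner_delta 0)/= hornerC.
have pp : rinner p p * r = 1.
  have pv : rinner p e0 = rinner p v.
    by rewrite -{1}Ep (pvm_sym pvmE)//; exact: l2_e0.
  (* As [p] has real entries, only the real part [r] of [v 0] survives in the pairing. *)
  rewrite -p0 pv vP [RHS]/rinner.
  rewrite (_ : (fun k => dot (p k) (_ k)) = r *: (fun k => dot (p k) (p k))).
    by rewrite lim_seriesZ; [exact: mulrC|exact: is_cvg_rinner].
  apply/funext => k.
  rewrite (_ : (_ *: p) k = v 0%N * p k)//.
  rewrite (_ : (r *: _) k = r * dot (p k) (p k))//.
  by rewrite /r /p /dot; case: (v 0%N) => v1 v2 /=; ring.
have r0 : 0 <= r.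
  by rewrite -rE pvm_rinner ?rinner_ge0//; exact: l2_e0.
have pcv : cd_kernel a b n x x @[n --> \oo] --> rinner p p.
  rewrite (_ : (fun n => _) = series (fun k => dot (p k) (p k))).
    exact: cvg_rinner.
  by apply/funext => n; exact: cd_kernelE.
exists r; split => //.
- by rewrite scalar_measureE// ?rE//; exact: l2_e0.
- move=> n; rewrite -pp ler_wpM2r//.
  have <- := cvg_lim (@Rhausdorff R) pcv.
  apply: nondecreasing_cvgn_le; last exact: (cvgP _ pcv).
  apply/nondecreasing_seqP => k.
  by rewrite /cd_kernel big_nat_recr//= lerDl -expr2 sqr_ge0.
- by rewrite -pp; apply: cvgM => //; exact: cvg_cst.
Qed.

(** The real-valued case, to be applied to real and imaginary parts. The raw set functions are
    traded for bundled measures and the atoms of [eta n] are the masses computed above. *)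
Lemma cvg_integral_eta (g : R -> R) :
  integrable (point_masses S) setT (fun x : mR => (g x)%:E) ->
  let eta n := density_measure (scalar_measure E e0)
    (fun x => cd_kernel a b n x x) in
  (forall n, integrable (eta n) setT (fun x : mR => (g x)%:E)) /\
  fine (\int[eta n]_x (g x)%:E)%E @[n --> \oo] -->
    fine (\int[point_masses S]_x (g x)%:E)%E.
Proof.
move=> + eta.
have [nu nuE] := scalar_measure_measure pvmE l2_e0.
have [nuoo nuooE] := point_masses_measure (S : set mR).
have mk n : measurable_fun setT (fun x : mR => (cd_kernel a b n x x)%:E).
  by apply/measurable_EFinP; exact: measurable_cd_kernel.
have k0 n (x : mR) : (0 <= (cd_kernel a b n x x)%:E)%E.
  by rewrite lee_fin cd_kernel_ge0.
have /choice[nu_ nu_E] : forall n, exists nu' : {measure set mR -> \bar R},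
    forall A, measurable A -> nu' A = (\int[nu]_(x in A) (cd_kernel a b n x x)%:E)%E.
  by move=> n; exact: density_measure_agreeing.
have etaE n A : measurable A -> eta n A = nu_ n A.
  by move=> mA; rewrite nu_E// /eta /density_measure (eq_integral_setfun _ _ nuE).
have cS := countable_real_spectrum.
have m1 (x : mR) : measurable [set x] by exact: measurable_set1.
have mS : measurable (S : set mR) by exact: countable_measurable.
have mSC := measurableC mS.
have nu_1 n (x : mR) : nu_ n [set x] = ((cd_kernel a b n x x)%:E * nu [set x])%E.
  rewrite nu_E// -integral_cst//; apply: eq_integral => y /set_mem -> //.
rewrite -(eq_integrable_setfun _ _ nuooE) => ig.
have [||||||ig_ cvg_] := @cvg_integral_countable_support R S nuoo nu_ g cS.
- by rewrite nuooE// point_massesC.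
- by move=> x Sx; rewrite nuooE// point_masses1.
- move=> n; rewrite nu_E//; apply: null_set_integral => //.
    exact: measurable_funTS.
  exact: null_compl_real_spectrum.
- move=> n x /real_spectrum_mass[r [mur _ r1 _]].
  by rewrite nu_1 nuE// mur -EFinM lee_fin.
- move=> x /real_spectrum_mass[r [mur _ _ r1]].
  under eq_fun do rewrite nu_1 nuE// mur -EFinM.
  by apply: cvg_EFin => //; exact: nearW.
- exact: ig.
split => [n|].
  by rewrite (eq_integrable_setfun _ _ (etaE n)); exact: ig_.
under eq_fun do rewrite (eq_integral_setfun _ _ (etaE _)).
rewrite -(eq_integral_setfun _ _ nuooE); apply: fine_cvg.
(* The limit is finite by integrability, which is what lets [fine] pass to the limit. *)
by rewrite fineK//; exact: integrable_fin_num ig.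
Qed.

End DiscreteSpectralMeasure.

Theorem theorem4p5 (R : realType) (a b : nat -> R) (apos : forall n, 0 < a n)
  (T : set (cseq R * cseq R))
  (Tsa : self_adjoint T) (JT : jacobi_operator a b `<=` T)
  (E : set (measurableTypeR R) -> cseq R -> cseq R)
  (ET : spectral_measure_of T E)
  (Tess : essential_spectrum T = set0) :
  let mu := scalar_measure E e0 in
  let eta n := density_measure mu (fun x => cd_kernel a b n x x) in
  let eta_oo := point_masses (real_spectrum T) in
  forall f : R -> R[i], cintegrable eta_oo f ->
    (forall n : nat, (0 < n)%N -> cintegrable (eta n) f) /\
    cintegral (eta n) f @[n --> \oo] --> cintegral eta_oo f.
Proof.
move=> mu eta eta_oo f [fRe fIm].
have [iRe cRe] := cvg_integral_eta apos Tsa JT ET Tess fRe.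
have [iIm cIm] := cvg_integral_eta apos Tsa JT ET Tess fIm.
split => [n _|]; first by split; [exact: iRe|exact: iIm].
exact: cvg_complex cRe cIm.
Qed.
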